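(* Let $G$ be a graph of order $n$ with minimum degree $\delta=\delta(G)$, let $\bar\delta=\delta(\overline{G})$ be the minimum degree of its complement $\overline{G}$, and let $\delta'=\min\{\delta,\bar\delta\}$. If $\delta'>0$, then $$ \gamma_g(G)\le\left(1-\frac{\delta'}{2^{1/\delta'}\,(1+\delta')^{1+1/\delta'}}\right)n . $$
   Context: All graphs are finite and undirected, without loops or multiple edges. A set $X\subseteq V(G)$ is a dominating set of $G$ if every vertex not in $X$ is adjacent in $G$ to a vertex in $X$. A set $X\subseteq V(G)$ is a global dominating set of $G$ if it is a dominating set both in $G$ and in its complement $\overline{G}$. The global domination number $\gamma_g(G)$ is the minimum cardinality of a global dominating set of $G$. *)

(* Defs.v *)
From mathcomp Require Import all_boot.
Set Implicit Arguments.
Unset Strict Implicit.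
Unset Printing Implicit Defensive.

(* A graph is an adjacency relation on a finite vertex type;
   the definitions make sense for any relation, and a simple undirected graph
   is one satisfying [simple_graph]. *)
Definition simple_graph (V : finType) (e : rel V) : Prop :=
  symmetric e /\ irreflexive e.

Definition compl_graph (V : finType) (e : rel V) : rel V :=
  [rel x y | (x != y) && ~~ e x y].

Definition degree (V : finType) (e : rel V) (x : V) : nat :=
  #|[set y | e x y]|.

(* The default value #|V| exceeds every degree of a loopless graph, so it is
   never the minimum unless V is empty, in which case the value is 0. *)
Definition min_degree (V : finType) (e : rel V) : nat :=
  \big[minn/#|V|]_(x : V) degree e x.

Definition dominating (V : finType) (e : rel V) (X : {set V}) : bool :=
  [forall x, (x \notin X) ==> [exists y in X, e x y]].

Definition global_dominating (V : finType) (e : rel V) (X : {set V}) : bool :=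
  dominating e X && dominating (compl_graph e) X.

(* The minimum is attained: the whole vertex set is global dominating. *)
Definition global_domination_number (V : finType) (e : rel V) : nat :=
  #|[arg min_(X < [set: V] | global_dominating e X) #|X|]|.

(* Main.v *)
(* Put every vertex into a random set A independently with probability 1 - q,
   and repair A by adding the vertices whose closed neighbourhood, in the graph
   or in its complement, misses A.  The result is global dominating, and its
   expected size is at most (1 - q + 2 q^(d+1)) n.  The bound is the value at the
   minimiser q = (2 (1 + d))^(-1/d). *)
Require Import Defs.
From mathcomp Require Import all_boot all_order all_algebra.
From mathcomp Require Import reals exp.
From mathcomp Require Import ring.
Import Order.TTheory GRing.Theory Num.Theory.
Local Open Scope ring_scope.

Definition closed_nbhd (V : finType) (e : rel V) (x : V) : {set V} :=
  x |: [set y | e x y].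

(** The family [S] is left arbitrary so that singletons can be used as well as closed
    neighbourhoods. *)
Definition missed (V : finType) (S : V -> {set V}) (A : {set V}) : {set V} :=
  [set x | [disjoint S x & A]].

(* The probability of A when each vertex is kept independently with
   probability 1 - q. *)
Definition set_weight (R : pzRingType) (V : finType) (q : R) (A : {set V}) : R :=
  \prod_(i : V) (if i \in A then 1 - q else q).

(** By independence, each vertex of [S] must be left out, at a factor [q], while every other vertex
    is free and contributes [(1 - q) + q = 1]. *)
Lemma sum_set_weight_disjoint (R : comNzRingType) (V : finType) (q : R)
    (S : {set V}) :
  \sum_(A : {set V} | [disjoint S & A]) set_weight R V q A = q ^+ #|S|.
Proof.
rewrite big_mkcond /=.
(* Expanding this product of sums gives one term per set [A] of vertices where the first summand is
   chosen; the summand 0 on [S] kills every [A] that meets [S]. *)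
transitivity (\prod_(i : V) ((if i \in S then 0 else 1 - q) + q)).
  rewrite bigA_distr; apply: eq_bigr => A _.
  case: ifPn => [dSA | /pred0Pn [i /andP [/= iS iA]]].
    apply: eq_bigr => i _; case: ifP => // iA.
    by rewrite (disjointFl dSA iA).
  by rewrite (bigD1 i) //= iA iS mul0r.
rewrite (bigID (mem S)) /= [X in _ * X]big1 => [|i /negPf ->]; last by rewrite subrK.
rewrite mulr1 -prodr_const; apply: eq_bigr => i ->; exact: add0r.
Qed.

Lemma sum_set_weight (R : comNzRingType) (V : finType) (q : R) :
  \sum_(A : {set V}) set_weight R V q A = 1.
Proof.
rewrite -[RHS](expr0 q) -(cards0 V) -sum_set_weight_disjoint.
by apply: eq_bigl => A; rewrite disjoint_sym disjoints_subset setC0 subsetT.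
Qed.

(** Linearity of expectation: the cardinal is a sum of indicators over [x], and the two sums are
    exchanged. *)
Lemma expected_card_missed (R : comNzRingType) (V : finType) (q : R)
    (S : V -> {set V}) :
  \sum_(A : {set V}) set_weight R V q A * #|missed V S A|%:R
  = \sum_(x : V) q ^+ #|S x|.
Proof.
under eq_bigr => A _.
  rewrite -sum1_card natr_sum mulr_sumr big_mkcond /=.
  over.
rewrite exchange_big /=; apply: eq_bigr => x _.
rewrite -sum_set_weight_disjoint [RHS]big_mkcond /=.
by apply: eq_bigr => A _; rewrite inE mulr1.
Qed.

Lemma expected_card (R : comNzRingType) (V : finType) (q : R) :
  \sum_(A : {set V}) set_weight R V q A * #|A|%:R = (1 - q) * #|V|%:R.
Proof.
(* The vertices whose singleton misses [A] form the complement of [A], so the previous expectation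
   applies. *)
have cardA (A : {set V}) : #|A|%:R = #|V|%:R - #|missed V set1 A|%:R :> R.
  have -> : missed V set1 A = ~: A by apply/setP => x; rewrite !inE disjoints1.
  by rewrite -(cardsC A) natrD addrK.
under eq_bigr do rewrite cardA mulrBr.
rewrite big_split /= sumrN -mulr_suml sum_set_weight expected_card_missed.
under [X in _ - X]eq_bigr do rewrite cards1.
by rewrite sumr_const mul1r mulrBl mul1r mulr_natr.
Qed.

(** For [x] outside [X], the closed neighbourhood of [x] meets [A]; the common point is not [x], as
    [A] lies in [X], so it is a neighbour of [x]. *)
Lemma dominating_repair (V : finType) (e : rel V) (A X : {set V}) :
  A \subset X -> missed V (closed_nbhd V e) A \subset X -> dominating e X.
Proof.
move=> sAX sBX; apply/forallP => x; apply/implyP => xX.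
have : x \notin missed V (closed_nbhd V e) A by apply: contra xX; apply: (subsetP sBX).
rewrite inE => /pred0Pn [y /andP [/=]]; rewrite !inE => /orP [/eqP -> | exy] yA.
  by rewrite (subsetP sAX) in xX.
by apply/existsP; exists y; rewrite (subsetP sAX).
Qed.

Lemma global_domination_number_le (V : finType) (e : rel V) (X : {set V}) :
  global_dominating e X -> (global_domination_number e <= #|X|)%N.
Proof.
move=> domX; rewrite /global_domination_number.
case: arg_minnP => [|Y _ minY]; last exact: minY.
by apply/andP; split; apply/forallP => x; rewrite in_setT.
Qed.

Lemma min_degree_le (V : finType) (e : rel V) (x : V) :
  (min_degree e <= degree e x)%N.
Proof.
rewrite /min_degree; elim: index_enum (mem_index_enum x) => // y s IHs.
rewrite inE big_cons geq_min => /predU1P [<- | /IHs ->]; first by rewrite leqnn.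
exact: orbT.
Qed.

Lemma card_closed_nbhd (V : finType) (e : rel V) (x : V) :
  irreflexive e -> #|closed_nbhd V e x| = (degree e x).+1.
Proof. by move=> irr; rewrite cardsU1 inE irr. Qed.

(** The exponent is [d.+1] because [x] is counted besides its neighbours; since [0 <= q <= 1], a
    larger neighbourhood only lowers the power. *)
Lemma sum_closed_nbhd_le (R : numDomainType) (V : finType) (e : rel V) (d : nat)
    (q : R) :
  irreflexive e -> (d <= min_degree e)%N -> 0 <= q <= 1 ->
  \sum_(x : V) q ^+ #|closed_nbhd V e x| <= q ^+ d.+1 * #|V|%:R.
Proof.
move=> irr le_d /andP [q0 q1].
rewrite mulr_natr -sumr_const; apply: ler_sum => x _.
rewrite card_closed_nbhd // ler_wiXn2l // ltnS.
exact: leq_trans le_d (min_degree_le _ _ _).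
Qed.

Lemma global_domination_number_prob (R : numDomainType) (V : finType) (e : rel V)
    (d : nat) (q : R) :
  irreflexive e -> (d <= min_degree e)%N -> (d <= min_degree (compl_graph e))%N ->
  0 <= q <= 1 ->
  (global_domination_number e)%:R <= (1 - q + 2 * q ^+ d.+1) * #|V|%:R.
Proof.
move=> irr le_d le_cd q01.
have irrC : irreflexive (compl_graph e) by move=> x; rewrite /compl_graph /= eqxx.
pose B e' A := missed V (closed_nbhd V e') A.
have le_card (A : {set V}) :
    (global_domination_number e <= #|A| + #|B e A| + #|B (compl_graph e) A|)%N.
  have dom : global_dominating e (A :|: B e A :|: B (compl_graph e) A).
    by apply/andP; split; apply: (dominating_repair _ _ A);
      apply/subsetP => x xA; rewrite !inE in xA *; rewrite xA ?orbT.
  apply: leq_trans (global_domination_number_le _ _ _ dom) _.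
  by rewrite (leq_trans (leq_card_setU _ _)) // leq_add2r leq_card_setU.
(* As the weights sum to 1, a constant is its own expectation, and [le_card] can be averaged over
   [A]. *)
have -> : (global_domination_number e)%:R
    = \sum_(A : {set V}) set_weight R V q A * (global_domination_number e)%:R.
  by rewrite -mulr_suml sum_set_weight mul1r.
have w0 (A : {set V}) : 0 <= set_weight R V q A.
  case/andP: q01 => q0 q1.
  by apply: prodr_ge0 => i _; case: ifP; rewrite ?subr_ge0.
apply: (@le_trans _ _ (\sum_(A : {set V}) set_weight R V q A
          * (#|A| + #|B e A| + #|B (compl_graph e) A|)%:R)).
  by apply: ler_sum => A _; rewrite (ler_wpM2l (w0 A)) // ler_nat le_card.
under eq_bigr do rewrite !natrD !mulrDr.
rewrite !big_split /= expected_card !expected_card_missed.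
rewrite -addrA [leRHS]mulrDl lerD2l -mulrA mulr_natl mulr2n.
by apply: lerD; apply: sum_closed_nbhd_le.
Qed.

Theorem theorem10 (R : realType) (V : finType) (e : rel V)
    (he : simple_graph e)
    (n : nat) (hn : #|V| = n)
    (delta : nat) (hdelta : delta = min_degree e)
    (cdelta : nat) (hcdelta : cdelta = min_degree (compl_graph e))
    (d : nat) (hd : d = minn delta cdelta)
    (hd0 : (0 < d)%N) :
  (global_domination_number e)%:R <=
    (1 - d%:R / (powR 2 (1 / d%:R) * powR (1 + d%:R) (1 + 1 / d%:R)))
      * n%:R :> R.
Proof.
have dn0 : d%:R != 0 :> R by rewrite pnatr_eq0 -lt0n.
have d1_gt0 : 0 < 1 + d%:R :> R by rewrite ltr_wpDr ?ler0n.
(* [r] is the inverse of the minimiser [q]. *)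
pose r : R := powR (2 * (1 + d%:R)) (1 / d%:R).
have r_gt0 : 0 < r by rewrite powR_gt0 // mulr_gt0.
have rX : r ^+ d = 2 * (1 + d%:R).
  by rewrite -powR_mulrn ?ltW // -powRrM mul1r mulVf // powRr1 // mulr_ge0 // ltW.
have r_ge1 : 1 <= r.
  by rewrite -(expr_ge1 hd0 (ltW r_gt0)) rX mulr_ege1 ?lerDl ?ler1n ?ler0n.
have q01 : 0 <= r^-1 <= 1 by rewrite invr_ge0 ltW //= invf_le1.
have -> : powR 2 (1 / d%:R) * powR (1 + d%:R) (1 + 1 / d%:R) = (1 + d%:R) * r.
  rewrite /r powRM ?ltW // powRD; last by rewrite (gt_eqF d1_gt0) implybT.
  by rewrite powRr1 ?ltW // mulrCA.
have [le_d le_cd] : (d <= min_degree e)%N /\ (d <= min_degree (compl_graph e))%N.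
  by rewrite hd hdelta hcdelta geq_minl geq_minr.
have := global_domination_number_prob R V e d r^-1 he.2 le_d le_cd q01.
(* With [q = r^-1], the value of [r ^+ d] turns [2 * q ^+ d.+1] into [q / (1 + d)], and [1 - q + q /
   (1 + d) = 1 - d / ((1 + d) * r)]. *)
rewrite hn exprS exprVn rX; congr (_ <= _ * _).
by field; rewrite !gt_eqF.
Qed.
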